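(* Let $\mathcal{H}$ be a complex separable Hilbert space and let $T\in\mathcal{B}(\mathcal{H})$ be a power-bounded operator. Then $T$ is of class $C_{\cdot 0}$ if and only if $\mathcal{M}(T)=\{0\}$.
   Context: $\mathcal{B}(\mathcal{H})$ is the space of bounded linear operators on $\mathcal{H}$. An operator $T\in\mathcal{B}(\mathcal{H})$ is power-bounded if $\sup_{n\ge 1}\|T^n\|<\infty$. An operator $A\in\mathcal{B}(\mathcal{H})$ is of class $C_{0\cdot}$ if $\liminf_{n\to\infty}\|A^n x\|=0$ for every $x\in\mathcal{H}$; it is of class $C_{\cdot 0}$ if its adjoint $A^*$ is of class $C_{0\cdot}$. With $\mathbb{N}=\{0,1,2,\dots\}$, $\mathcal{M}(T)$ denotes the set of all $x\in\mathcal{H}$ for which there exists a bounded sequence $\{x_n\}_{n\in\mathbb{N}}\subset\mathcal{H}$ with $x_0=x$ and $Tx_{n+1}=x_n$ for all $n\in\mathbb{N}$. *)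

(* Defs.v *)
From HB Require Import structures.
From mathcomp Require Import all_boot all_order all_algebra.
From mathcomp Require Import complex.
From mathcomp Require Import all_classical reals ereal topology normedtype sequences.

Set Implicit Arguments.
Unset Strict Implicit.
Unset Printing Implicit Defensive.

Import Order.TTheory GRing.Theory Num.Theory.
Import numFieldNormedType.Exports.

Local Open Scope classical_set_scope.
Local Open Scope ring_scope.

Definition separable (X : topologicalType) : Prop :=
  exists2 D : set X, countable D & dense D.

Section Operators.
Variables (R : realType) (H : completeNormedModType R[i]).

(* On a normed module over R[i] the norm `|x| is an element of R[i] (a
   nonnegative real one); its real part is the norm as an element of R. *)
Definition rnorm (x : H) : R := complex.Re `|x|.

(* Extended-real valued, so that it makes sense for unbounded maps. *)
Definition opnorm (A : H -> H) : \bar R :=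
  ereal_sup [set (rnorm (A x))%:E | x in [set x | rnorm x <= 1]].

Definition bounded_operator (A : {linear H -> H}) : Prop := (opnorm A < +oo)%E.

Definition power_bounded (T : {linear H -> H}) : Prop :=
  (ereal_sup [set opnorm (iter n T) | n in [set n | (1 <= n)%N]] < +oo)%E.

Definition class_C0dot (A : {linear H -> H}) : Prop :=
  forall x : H, limn_einf (fun n => (rnorm (iter n A x))%:E) = 0%E.

Definition is_adjoint (dot : H -> H -> R[i]) (A B : {linear H -> H}) : Prop :=
  bounded_operator B /\ forall x y : H, dot (A x) y = dot x (B y).

(* For an inner product on H inducing its norm, a bounded operator has exactly
   one adjoint, by the Riesz representation theorem. *)
Definition class_Cdot0 (dot : H -> H -> R[i]) (A : {linear H -> H}) : Prop :=
  exists2 B : {linear H -> H}, is_adjoint dot A B & class_C0dot B.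

Definition bounded_backward_orbits (T : {linear H -> H}) : set H :=
  [set x | exists u : nat -> H,
     [/\ bounded_fun u, u 0%N = x & forall n, T (u n.+1) = u n]].

End Operators.

(* Main.v *)
Require Import Defs.
From HB Require Import structures.
From mathcomp Require Import all_boot all_order all_algebra.
From mathcomp Require Import complex ring lra.
From mathcomp Require Import all_classical reals ereal topology normedtype sequences.
Import Order.TTheory GRing.Theory Num.Theory.
Import numFieldNormedType.Exports.
Local Open Scope classical_set_scope.
Local Open Scope ring_scope.

(** Write [B] for the adjoint of [T].

    If [B] is of class [C_0.] and [x = u 0 = T^n (u n)] with [u] bounded, then
    [<x, x> = <u n, B^n x>] is at most a constant times [|B^n x|], which comes
    arbitrarily close to [0]; hence [x = 0].

    Conversely, fix [y] and a free ultrafilter [U] on the natural numbers.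
    Power-boundedness makes [T^(n-k) (B^n y)] bounded in [n] and [k], so these
    vectors have weak limits [x_k] along [U] with a common bound
    ([ultra_weak_cvg]).  Since [T] is weakly continuous and
    [T (T^(n-(k+1)) (B^n y)) = T^(n-k) (B^n y)] for [n > k], the [x_k] form a
    bounded backward orbit of [x_0].  Moreover
    [<T^n (B^n y), y> = |B^n y|^2], so [<x_0, y>] is the limit of [|B^n y|^2]
    along [U] ([adjoint_orbit_limit]).  If [M(T)] is trivial, [x_0 = 0], so
    [|B^n y|] is arbitrarily small on members of [U], in particular for
    arbitrarily large [n].  Letting the exponent of [T] lag behind by [k] is what
    makes the limits consistent: [x_(k+1)] and [x_k] are limits along the same
    [U] with the same [B^n], so [U] need not be shift-invariant.

    The weak limits and the adjoint both come from the Riesz representation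
    theorem.  It is proved here for the real inner product [Re <x, y>]
    ([real_riesz]), which keeps all limits and inequalities in [R]; complex
    linearity is recovered at the end from [Re <i x, y> = - Im <x, y>]. *)

(** * Inequalities and limits of real sequences *)

(** Besides the Cauchy-Schwarz inequality, this gives in [real_riesz] the
    first-order condition at an almost minimizer. *)
Lemma sqr_le_of_quad_ge0 (R : realFieldType) (a b c : R) : 0 <= c ->
  (forall t, 0 <= a + 2 * t * b + t ^+ 2 * c) -> b ^+ 2 <= a * c.
Proof.
rewrite le_eqVlt => /predU1P[<- h|c0 h].
  rewrite mulr0; have [->|b0] := eqVneq b 0; first by rewrite expr0n.
  have := h (- (a + 1) / (2 * b)); rewrite mulr0 addr0.
  rewrite (_ : a + _ = -1); first by rewrite ler0N1.
  by field.
have := h (- b / c); rewrite -(ler_pM2r c0) mul0r.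
rewrite [X in _ <= X](_ : _ = a * c - b ^+ 2) ?subr_ge0//.
by field; rewrite gt_eqF.
Qed.

(** The image ultrafilter contains a compact segment. *)
Lemma ultra_bounded_cvg (R : realType) (I : Type) (U : set_system I) (a : I -> R)
    (C : R) : UltraFilter U -> (forall i, `|a i| <= C) ->
  exists l : R, a i @[i --> U] --> l.
Proof.
move=> UU aC.
have [G [GU aG]] := @ultraFilterLemma _ (a @ U) _.
have [l [_ Gl]] : `[- C, C]%classic `&` [set l | G --> l] !=set0.
  have := @segment_compact R (- C) C; rewrite compact_ultra; apply.
  apply: aG; apply: (@filterE _ U) => i /=.
  by rewrite in_itv/= -ler_norml; exact: aC.
exists l => N Nl.
have [//|UN] := in_ultra_setVsetC (a @^-1` N) UU.
have : G (~` N) by apply: aG.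
by move=> /(filterI (Gl _ Nl)); rewrite setICr => /filter_not_empty.
Qed.

(** The negation of [u n <= e] for some [n >= N] bounds the infimum of every
    tail from [N] on below by [e]. *)
Lemma limn_einf_eq0P (R : realType) (u : nat -> R) : (forall n, 0 <= u n) ->
  limn_einf (fun n => (u n)%:E) = 0%E <->
  forall e N, 0 < e -> exists2 n, (N <= n)%N & u n <= e.
Proof.
move=> u0; rewrite limn_einf_lim; split => [ul e N e0|ul].
  apply: contrapT => nex.
  have : (e%:E <= limn (einfs (fun n => (u n)%:E)))%E.
    apply: lime_ge; first exact: is_cvg_einfs.
    exists N => // n /= Nn; apply: le_ereal_inf_tmp => _ [k /= nk <-].
    rewrite lee_fin leNgt; apply/negP => uke; apply: nex.
    by exists k; [exact: leq_trans nk|exact: ltW].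
  by rewrite ul lee_fin leNgt e0.
apply/eqP; rewrite eq_le; apply/andP; split.
  apply/lee_addgt0Pr => e e0; rewrite add0e.
  apply: lime_le; first exact: is_cvg_einfs.
  apply: nearW => n; have [k nk uk] := ul e n e0.
  by apply: (@le_trans _ _ (u k)%:E); [apply: ereal_inf_lbound; exists k|rewrite lee_fin].
apply: lime_ge; first exact: is_cvg_einfs.
by apply: nearW => n; apply: le_ereal_inf_tmp => _ [k /= _ <-]; rewrite lee_fin.
Qed.

(** * The real inner product and the Riesz representation theorem *)

Section RealInnerProduct.
Context {R : realType} {H : completeNormedModType R[i]}.

Lemma rnormE (x : H) : `|x| = (rnorm x)%:C%C.
Proof. by rewrite /rnorm RRe_real// ger0_real. Qed.

Lemma rnorm_ge0 (x : H) : 0 <= rnorm x.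
Proof. by rewrite -ler0c -rnormE. Qed.

Lemma gt0_complexE (e : R[i]) : 0 < e -> exists2 d : R, 0 < d & e = d%:C%C.
Proof.
by case: e => a b; rewrite ltcE/= => /andP[/eqP -> a0]; exists a.
Qed.

Lemma rnorm0 : rnorm (0 : H) = 0.
Proof. by rewrite /rnorm normr0. Qed.

Lemma rnorm_eq0 (x : H) : rnorm x = 0 -> x = 0.
Proof. by move=> x0; apply: normr0_eq0; rewrite rnormE x0. Qed.

Lemma rnormZ (a : R) (x : H) : rnorm (a%:C%C *: x) = `|a| * rnorm x.
Proof.
apply: complexI; rewrite -rnormE normrZ rnormE rmorphM/=; congr (_ * _).
by rewrite normc_def/= expr0n addr0 sqrtr_sqr.
Qed.

Variable dot : {dot H for Num.conj}.

Definition rdot (x y : H) : R := complex.Re (dot x y).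

Lemma rdotC x y : rdot x y = rdot y x.
Proof. by rewrite /rdot hermC expr0 mul1r /=; case: (dot y x). Qed.

Lemma rdotDl x y z : rdot (x + y) z = rdot x z + rdot y z.
Proof. by rewrite /rdot linearDl raddfD. Qed.

Lemma rdotDr x y z : rdot x (y + z) = rdot x y + rdot x z.
Proof. by rewrite !(rdotC x) rdotDl. Qed.

Lemma rdotZl (a : R) x y : rdot (a%:C%C *: x) y = a * rdot x y.
Proof. by rewrite /rdot linearZl_LR/=; case: (dot x y) => u v /=; rewrite mul0r subr0. Qed.

Lemma rdotZr (a : R) x y : rdot x (a%:C%C *: y) = a * rdot x y.
Proof. by rewrite !(rdotC x) rdotZl. Qed.

Lemma rdot_iZl x y : rdot ('i%C *: x) y = - complex.Im (dot x y).
Proof. by rewrite /rdot linearZl_LR/= mulrC ReiNIm. Qed.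

Lemma dot_eq_of_rdot_eq x y x' y' :
  rdot x y = rdot x' y' -> rdot ('i%C *: x) y = rdot ('i%C *: x') y' ->
  dot x y = dot x' y'.
Proof.
rewrite !rdot_iZl /rdot; case: (dot x y) (dot x' y') => a b [c d] /= -> /eqP.
by rewrite eqr_opp => /eqP ->.
Qed.

Hypothesis dot_norm : forall x : H, dot x x = `|x| ^+ 2.

Lemma rdotxx x : rdot x x = rnorm x ^+ 2.
Proof. by rewrite /rdot dot_norm rnormE -rmorphXn. Qed.

Lemma rdot_inj x y : (forall z, rdot z x = rdot z y) -> x = y.
Proof.
move=> h; apply/eqP; rewrite -subr_eq0; apply/eqP/rnorm_eq0.
have : rdot (x - y) (x - y) = 0.
  by rewrite rdotDr -[- y]scaleN1r -(rmorphN1 (real_complex R)) rdotZr h mulN1r subrr.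
by rewrite rdotxx => /eqP; rewrite expf_eq0/= => /eqP.
Qed.

Lemma rdot_le x y : `|rdot x y| <= rnorm x * rnorm y.
Proof.
rewrite -ler_sqr ?nnegrE ?mulr_ge0 ?rnorm_ge0// real_normK ?num_real// exprMn.
apply: sqr_le_of_quad_ge0 => [|t]; first exact: sqr_ge0.
rewrite -!rdotxx (_ : _ + _ = rdot (x + t%:C%C *: y) (x + t%:C%C *: y)).
  by rewrite rdotxx sqr_ge0.
rewrite rdotDl !rdotDr !rdotZl !rdotZr (rdotC y x); ring.
Qed.

(** The representing vector is the minimizer of [J x = |x|^2 - 2 f x].  The
    parallelogram law makes minimizing sequences Cauchy; rather than passing to
    the limit in [J], the first-order condition is estimated at vectors [y] that
    nearly minimize [J], where it holds up to [e |h|], and then transported to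
    the limit [v] by Cauchy-Schwarz. *)
Lemma real_riesz (f : H -> R) (C : R) :
  {morph f : x y / x + y} -> (forall (a : R) x, f (a%:C%C *: x) = a * f x) ->
  (forall x, f x <= C * rnorm x) -> exists v, forall x, f x = rdot x v.
Proof.
move=> fD fZ fC; pose J x := rdot x x - 2 * f x.
have Jlb : has_lbound (range J).
  exists (- C ^+ 2) => _ [x _ <-]; rewrite /J rdotxx.
  by have := fC x; have := sqr_ge0 (rnorm x - C); nra.
have [m mJ Jm] : exists2 m, forall x, m <= J x
    & forall e, 0 < e -> exists x, J x < m + e.
  exists (inf (range J)) => [x|e e0]; first by apply: ge_inf => //; exists x.
  have Jinf : has_inf (range J) by split => //; exists (J 0), 0.
  by have [_ [x _ <-] xm] := inf_adherent e0 Jinf; exists x.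
(* [2 (J x + J y) - 4 J ((x + y) / 2)] equals [|x - y|^2]. *)
have par x y : rnorm (x - y) ^+ 2 <= 2 * (J x + J y - 2 * m).
  have := mJ ((2^-1)%:C%C *: (x + y)).
  rewrite -rdotxx /J -[- y]scaleN1r -(rmorphN1 (real_complex R)).
  rewrite !(fZ, fD, rdotZl, rdotZr, rdotDl, rdotDr) (rdotC y x); lra.
(* With the defect [1 / (n + 1) ^ 2], [par] puts all later terms within
   [2 / (N + 1)] of [x_ N]. *)
have /choice[x_ x_m] (n : nat) : exists x, J x < m + (n.+1%:R^-1) ^+ 2.
  by apply: Jm; rewrite exprn_gt0.
have xv : cvg (x_ @ \oo).
  apply: cauchy_cvg; apply: cauchy_exP => e e0.
  have [d d0 ->] := gt0_complexE _ e0.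
  have /filter_ex[N Nd] := near_infty_natSinv_lt (PosNum (divr_gt0 d0 (ltr0n R 2))).
  exists (x_ N); exists N => // n /= Nn; rewrite -ball_normE /= rnormE ltcR.
  move: Nd => /=; set q := (N.+1%:R^-1 : R) => qd.
  have q0 : 0 < q by rewrite invr_gt0.
  have nq : (n.+1%:R^-1 : R) ^+ 2 <= q ^+ 2.
    by rewrite ler_sqr ?nnegrE ?invr_ge0// /q lef_pV2 ?posrE// ler_nat.
  have : rnorm (x_ N - x_ n) ^+ 2 <= (2 * q) ^+ 2.
    have := par (x_ N) (x_ n); have := x_m n; have := x_m N; rewrite -/q.
    move: nq; move: (_^-1) => p; lra.
  by rewrite ler_sqr ?nnegrE ?rnorm_ge0//; lra.
set v := lim (x_ @ \oo) in xv; exists v => h.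
(* [J (y + t h) >= m] for all [t] is the quadratic inequality used here. *)
have key e : 0 < e -> `|f h - rdot h v| <= 2 * e * rnorm h.
  move=> e0.
  have [y ym yv] : exists2 y, J y < m + e ^+ 2 & rnorm (v - y) <= e.
    have : \forall n \near \oo, J (x_ n) < m + e ^+ 2 /\ rnorm (v - x_ n) <= e.
      near=> n; split.
        apply: lt_trans (x_m n) _; rewrite ltrD2l ltr_sqr ?nnegrE ?(ltW e0)//.
        near: n; exact: (near_infty_natSinv_lt (PosNum e0)).
      rewrite -lecR -rnormE; near: n.
      by move/cvgrPdist_le: xv; apply; rewrite ltcR.
    by move=> /filter_ex[n [? ?]]; exists (x_ n).
  have : `|rdot h y - f h| <= e * rnorm h.
    rewrite -ler_sqr ?nnegrE ?mulr_ge0 ?rnorm_ge0// ?(ltW e0)//.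
    rewrite real_normK ?num_real// exprMn.
    apply: sqr_le_of_quad_ge0 => [|t]; first exact: sqr_ge0.
    have := mJ (y + t%:C%C *: h); move: ym; rewrite -!rdotxx /J.
    rewrite !(fZ, fD, rdotZl, rdotZr, rdotDl, rdotDr) (rdotC y h); lra.
  have : `|rdot h (v - y)| <= e * rnorm h.
    by rewrite (le_trans (rdot_le _ _))// mulrC ler_wpM2r ?rnorm_ge0.
  rewrite -[- y]scaleN1r -(rmorphN1 (real_complex R)) rdotDr rdotZr.
  rewrite !ler_norml; lra.
apply/eqP; rewrite -subr_eq0 -normr_le0; apply/ler_addgt0Pr => e e0.
rewrite add0r.
have n0 := rnorm_ge0 h.
have d0 : 0 < 2 * (rnorm h + 1) by lra.
apply: le_trans (key _ (divr_gt0 e0 d0)) _.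
rewrite [X in X <= _](_ : _ = e * (rnorm h / (rnorm h + 1))); last by field; lra.
by rewrite ler_piMr ?(ltW e0)// ler_pdivrMr; lra.
Unshelve. all: by end_near. Qed.

End RealInnerProduct.

(** * Norm bounds for operators and orbits *)

Section Operators.
Context {R : realType} {H : completeNormedModType R[i]}.

(** Real homogeneity is all that rescaling to the unit ball takes; stating it
    for bare functions covers the iterates [iter n T]. *)
Lemma opnorm_leP (f : H -> H) (C : R) :
  (forall (a : R) x, f (a%:C%C *: x) = a%:C%C *: f x) -> 0 <= C ->
  (opnorm f <= C%:E)%E <-> forall x, rnorm (f x) <= C * rnorm x.
Proof.
move=> fZ C0; split => [fC x|fC]; last first.
  apply: ge_ereal_sup => _ [x /= x1 <-]; rewrite lee_fin.
  by apply: le_trans (fC x) _; rewrite ler_piMr.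
have [x0|x0] := eqVneq (rnorm x) 0.
  have f0 : f 0 = 0 by have := fZ 0 0; rewrite scaler0 scale0r.
  by rewrite (rnorm_eq0 _ x0) f0 rnorm0 mulr_ge0 ?rnorm_ge0.
have xp : 0 < rnorm x by rewrite lt0r x0 rnorm_ge0.
have : ((rnorm (f ((rnorm x)^-1%:C%C *: x)))%:E <= C%:E)%E.
  apply: le_trans fC; apply: ereal_sup_ubound; exists ((rnorm x)^-1%:C%C *: x) => //=.
  by rewrite rnormZ gtr0_norm ?invr_gt0// mulVf.
by rewrite lee_fin fZ rnormZ gtr0_norm ?invr_gt0// ler_pdivrMl// mulrC.
Qed.

Lemma ltey_le_bound (x : \bar R) : (x < +oo)%E ->
  exists2 C : R, 0 <= C & (x <= C%:E)%E.
Proof.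
case: x => [r _|//|_]; last by exists 0; rewrite ?leNye.
by exists `|r|; rewrite ?lee_fin ?ler_norm.
Qed.

Lemma bounded_operatorP (A : {linear H -> H}) : bounded_operator A <->
  exists2 C, 0 <= C & forall x, rnorm (A x) <= C * rnorm x.
Proof.
have AZ (a : R) x : A (a%:C%C *: x) = a%:C%C *: A x by rewrite linearZ.
split => [/ltey_le_bound[C C0 AC]|[C C0 AC]].
  by exists C => //; apply/opnorm_leP.
by apply: le_lt_trans (ltry C); apply/opnorm_leP.
Qed.

Lemma power_boundedP (T : {linear H -> H}) : power_bounded T ->
  exists2 C, 0 <= C & forall n x, rnorm (iter n T x) <= C * rnorm x.
Proof.
move=> /ltey_le_bound[C C0 TC]; exists (C + 1) => [|[|n] x]; first exact: addr_ge0.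
  by rewrite ler_peMl ?rnorm_ge0// lerDr.
(* The supremum only controls positive powers; the [+ 1] above covers the
   identity. *)
apply: (@le_trans _ _ (C * rnorm x)); last by rewrite ler_wpM2r ?rnorm_ge0 ?lerDl.
apply: (opnorm_leP (iter n.+1 T) C _ C0).1 => [a y|].
  by elim: n.+1 => //= k ->; rewrite linearZ.
by apply: le_trans TC; apply: ereal_sup_ubound; exists n.+1.
Qed.

Lemma bounded_fun_rnorm (u : nat -> H) (C : R) :
  (forall n, rnorm (u n) <= C) -> bounded_fun u.
Proof.
move=> uC; exists C%:C%C; split; first by rewrite complex_real.
by move=> x Cx n _ /=; rewrite (le_trans _ (ltW Cx))// rnormE lecR.
Qed.

Lemma rnorm_bounded_fun (u : nat -> H) : bounded_fun u ->
  exists2 C, 0 <= C & forall n, rnorm (u n) <= C.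
Proof.
(* Only numbers strictly above [m] are known to be bounds. *)
move=> [M [/complex_realP[m ->] uM]].
exists (`|m| + 1) => [|n]; first by rewrite addr_ge0.
rewrite -lecR -rnormE; apply: uM => //; rewrite ltcR.
by rewrite (le_lt_trans (ler_norm m))// ltrDl.
Qed.

(** * Adjoints and weak limits *)

Variable dot : {dot H for Num.conj}.
Hypothesis dot_norm : forall x : H, dot x x = `|x| ^+ 2.

Local Notation rdot := (rdot dot).

(** Evaluate at [x = B y]: [|B y|^2 = <A (B y), y> <= C |B y| |y|]. *)
Lemma adjoint_le (A B : H -> H) (C : R) : 0 <= C ->
  (forall x, rnorm (A x) <= C * rnorm x) ->
  (forall x y, rdot (A x) y = rdot x (B y)) ->
  forall y, rnorm (B y) <= C * rnorm y.
Proof.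
move=> C0 AC AB y.
have [->|By0] := eqVneq (rnorm (B y)) 0; first by rewrite mulr_ge0 ?rnorm_ge0.
rewrite -(@ler_pM2l _ (rnorm (B y))) ?lt0r ?By0 ?rnorm_ge0//.
rewrite -expr2 -(rdotxx _ dot_norm) -AB.
apply: le_trans (ler_norm _) _; apply: le_trans (rdot_le _ dot_norm _ _) _.
by rewrite mulrA [_ * C]mulrC ler_wpM2r ?rnorm_ge0.
Qed.

Lemma exists_adjoint (T : {linear H -> H}) : bounded_operator T ->
  exists B : {linear H -> H}, is_adjoint dot T B.
Proof.
move=> /bounded_operatorP[C C0 TC].
have /choice[B TB] (y : H) : exists v, forall x, rdot (T x) y = rdot x v.
  apply: (real_riesz _ dot_norm _ (C * rnorm y)) => [x z|a x|x].
  - by rewrite raddfD rdotDl.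
  - by rewrite linearZ rdotZl.
  apply: le_trans (ler_norm _) _; apply: le_trans (rdot_le _ dot_norm _ _) _.
  by rewrite mulrAC ler_wpM2r ?rnorm_ge0.
have dTB x y : dot (T x) y = dot x (B y).
  by apply: dot_eq_of_rdot_eq => //; rewrite -TB linearZ.
have Blin : linear B.
  move=> a x y; apply: (rdot_inj _ dot_norm) => z.
  by rewrite -TB /rdot !linearDr !linearZr_LR /= !dTB.
pose B' : {linear H -> H} := HB.pack B (GRing.isLinear.Build _ _ _ _ _ Blin).
exists B'; split => //; apply/bounded_operatorP; exists C => //.
by apply: adjoint_le C0 TC _ => x y; rewrite TB.
Qed.

Lemma rdot_iter_adjoint (T B : H -> H) :
  (forall x y, rdot (T x) y = rdot x (B y)) ->
  forall n x y, rdot (iter n T x) y = rdot x (iter n B y).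
Proof. by move=> TB; elim=> //= n IH x y; rewrite TB IH -iterSr. Qed.

(** Weak compactness of balls: the limits [f z] of [<z, a i>] define a bounded
    real-linear functional of [z], which the Riesz theorem represents. *)
Lemma ultra_weak_cvg (I : Type) (U : set_system I) (a : I -> H) (C : R) :
  UltraFilter U -> (forall i, rnorm (a i) <= C) ->
  exists2 l, rnorm l <= C & forall z, rdot (a i) z @[i --> U] --> rdot l z.
Proof.
move=> UU aC.
have bnd z i : `|rdot z (a i)| <= C * rnorm z.
  by rewrite (le_trans (rdot_le _ dot_norm _ _))// mulrC ler_wpM2r ?rnorm_ge0.
have /choice[f af] z : exists l : R, rdot z (a i) @[i --> U] --> l.
  exact: ultra_bounded_cvg (bnd z).
have [l fl] : exists l, forall x, f x = rdot x l.
  apply: (real_riesz _ dot_norm _ C) => [x y|c x|x].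
  - have fa : rdot (x + y) (a i) @[i --> U] --> f x + f y.
      by under eq_fun do rewrite rdotDl; exact: cvgD.
    exact: (@cvg_unique _ (@Rhausdorff R) _ _ _ _ (af _)) fa.
  - have fa : rdot (c%:C%C *: x) (a i) @[i --> U] --> c * f x.
      by under eq_fun do rewrite rdotZl; apply: cvgMr; exact: af.
    exact: (@cvg_unique _ (@Rhausdorff R) _ _ _ _ (af _)) fa.
  - apply: cvgr_to_le (af x) _; apply: nearW => i.
    exact: le_trans (ler_norm _) (bnd x i).
exists l; last first.
  by move=> z; rewrite rdotC -fl; under eq_fun do rewrite rdotC; exact: af.
have [->|l0] := eqVneq (rnorm l) 0.
  by have [i _] := @filter_ex _ U _ setT filterT; exact: le_trans (rnorm_ge0 _) (aC i).
rewrite -(@ler_pM2r _ (rnorm l)) ?lt0r ?l0 ?rnorm_ge0//.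
rewrite -expr2 -(rdotxx _ dot_norm) -fl.
by apply: cvgr_to_le (af l) _; apply: nearW => i; exact: le_trans (ler_norm _) (bnd l i).
Qed.

(** The vector [x0] is the weak limit along [U] of [T^n (B^n y)], and its
    backward orbit consists of the weak limits of [T^(n-k) (B^n y)]. *)
Lemma adjoint_orbit_limit (T B : {linear H -> H}) (C : R) (U : set_system nat) (y : H) :
  0 <= C -> UltraFilter U -> \oo `<=` U ->
  (forall n x, rnorm (iter n T x) <= C * rnorm x) ->
  (forall x y, rdot (T x) y = rdot x (B y)) ->
  exists2 x0, bounded_backward_orbits T x0 &
    (rnorm (iter n B y) ^+ 2 @[n --> U] --> rdot x0 y).
Proof.
move=> C0 UU ooU TC TB.
have BC n : forall x, rnorm (iter n B x) <= C * rnorm x.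
  exact: adjoint_le C0 (TC n) (rdot_iter_adjoint _ _ TB n).
have aC k n : rnorm (iter (n - k) T (iter n B y)) <= C * (C * rnorm y).
  by rewrite (le_trans (TC _ _))// ler_wpM2l.
have /choice[x xP] k : exists l, rnorm l <= C * (C * rnorm y) /\
    forall z, rdot (iter (n - k) T (iter n B y)) z @[n --> U] --> rdot l z.
  by have [l ? ?] := ultra_weak_cvg _ _ _ _ UU (aC k); exists l.
exists (x 0%N).
  exists x; split => //; first by exact: bounded_fun_rnorm (fun n => (xP n).1).
  move=> k; apply: (rdot_inj _ dot_norm) => z; rewrite rdotC [RHS]rdotC TB.
  apply: (@cvg_unique _ (@Rhausdorff R) _ _ _ _ ((xP k.+1).2 (B z))).
  apply: cvg_trans ((xP k).2 z); apply: near_eq_cvg.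
  apply: ooU; exists k.+1 => // n /= kn.
  by rewrite -TB -iterS -subSn// subSS.
apply: cvg_trans ((xP 0%N).2 y); apply: near_eq_cvg; apply: nearW => n.
by rewrite subn0 (rdot_iter_adjoint _ _ TB) (rdotxx _ dot_norm).
Qed.

End Operators.

(** * Operators of class C.0 and bounded backward orbits *)

Theorem theorem3p5 (R : realType) (H : completeNormedModType R[i])
    (dot : {dot H for Num.conj})
    (dot_norm : forall x : H, dot x x = `|x| ^+ 2)
    (H_separable : separable H)
    (T : {linear H -> H})
    (T_bounded : bounded_operator T)
    (T_power_bounded : power_bounded T) :
  class_Cdot0 dot T <-> bounded_backward_orbits T = [set 0].
Proof.
split => [[B [_ TB] B0]|M0].
  apply/seteqP; split => [_ [u [/rnorm_bounded_fun[C C0 uC] <- Tu]]|_ ->]; last first.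
    exists (fun=> 0); split => // [|n]; last by rewrite raddf0.
    by apply: (bounded_fun_rnorm _ 0) => n; rewrite rnorm0.
  apply: rnorm_eq0.
  have uT n : iter n T (u n) = u 0%N by elim: n => // n IH; rewrite iterSr Tu.
  have rTB x y : rdot dot (T x) y = rdot dot x (B y) by rewrite /rdot TB.
  apply/eqP; rewrite -sqrf_eq0 eq_le sqr_ge0 andbT; apply/ler_addgt0Pr => e e0.
  have C1 : 0 < C + 1 by rewrite ltr_wpDl.
  have Bge n : 0 <= rnorm (iter n B (u 0%N)) by exact: rnorm_ge0.
  (* [C + 1] rather than [C], which may vanish. *)
  have [n _ nd] := (limn_einf_eq0P _ _ Bge).1 (B0 (u 0%N)) _ 0%N (divr_gt0 e0 C1).
  rewrite add0r -(rdotxx _ dot_norm) -{1}(uT n) (rdot_iter_adjoint _ _ _ rTB).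
  apply: le_trans (ler_norm _) _; apply: le_trans (rdot_le _ dot_norm _ _) _.
  apply: le_trans (ler_pM (rnorm_ge0 _) (rnorm_ge0 _) (uC n) nd) _.
  by rewrite mulrA ler_pdivrMr// mulrC ler_pM2l// lerDl.
have [B TB] := exists_adjoint _ dot_norm _ T_bounded; exists B => //.
have rTB x y : rdot dot (T x) y = rdot dot x (B y) by rewrite /rdot TB.2.
have [C C0 TC] := power_boundedP _ T_power_bounded => y.
apply/limn_einf_eq0P => [n|e N e0]; first exact: rnorm_ge0.
have [U [UU ooU]] := ultraFilterLemma eventually_filter.
have [x] := adjoint_orbit_limit _ dot_norm _ _ _ _ y C0 UU ooU TC rTB.
rewrite M0 => ->; have -> : rdot dot 0 y = 0 by rewrite /rdot linear0l.
move=> /cvgrPdist_lt/(_ (e ^+ 2)) h.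
have [n [Nn ne]] := filter_ex (filterI (ooU _ (nbhs_infty_ge N)) (h (exprn_gt0 2 e0))).
exists n => //; move: ne; rewrite sub0r normrN ger0_norm ?sqr_ge0//.
by rewrite ltr_sqr ?nnegrE ?rnorm_ge0 ?(ltW e0)// => /ltW.
Qed.
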